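(* Let $p$ be an odd prime number and let $G$ be the extraspecial $p$-group of exponent $p$ and of order $p^{2n+1}$, where $n\ge 1$. Present $G$ as a central extension $0\to V\xrightarrow{\iota}G\xrightarrow{\pi}U\to 0$, where $V=\langle v\rangle$ is one-dimensional over $\mathbb{F}_p$ with $\iota(V)=Z(G)=[G,G]$, and $U$ is the $\mathbb{F}_p$-vector space with basis $u_1,\dots,u_{2n}$, such that (for lifts of the $u_j$ to $G$) $[u_{2i-1},u_{2i}]=v$ for $1\le i\le n$ and $[u_j,u_l]=1$ for all $j<l$ with $(j,l)$ not of the form $(2i-1,2i)$. Define $\gamma:\wedge^2U\to V$ by $\iota(\gamma(\pi(g_1)\wedge\pi(g_2)))=[g_1,g_2]$ for $g_1,g_2\in G$. Then $K^3_{\max}/K^3=\{0\}$.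
   Context: Commutators are $[g_1,g_2]=g_1g_2g_1^{-1}g_2^{-1}$. An extraspecial $p$-group is a group $G$ with $Z(G)=\langle v\rangle\simeq C_p$ and $G/\langle v\rangle$ elementary abelian of order $p^{2n}$ for some $n\ge 1$, with commutators as described (so $[G,G]=Z(G)$). Let $\gamma^*:V^*\to\wedge^2U^*$ be the dual of $\gamma$ (where $\wedge^2U^*=\wedge^2(U^* )$). The non-degenerate pairing $\wedge^dU\times\wedge^dU^*\to\mathbb{F}_p$ is $\langle\langle x_1\wedge\cdots\wedge x_d, f_1\wedge\cdots\wedge f_d\rangle\rangle=\sum_{\tau\in S_d}\varepsilon(\tau)f_1(x_{\tau(1)})\cdots f_d(x_{\tau(d)})$, with $\varepsilon$ the sign, and $\bot$ denotes orthogonal complement for this pairing. Define $K^3=\gamma^*(V^* )\wedge U^*\subset\wedge^3U^*$, $S^3=(K^3)^\bot\subset\wedge^3U$, $S^3_{\mathrm{dec}}=$ the $\mathbb{F}_p$-span of all elements of $S^3$ of the form $u'\wedge u$ with $u'\in\wedge^2U$, $u\in U$, and $K^3_{\max}=(S^3_{\mathrm{dec}})^\bot\subset\wedge^3U^*$ (so $K^3\subset K^3_{\max}$). *)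

(* Defs.v *)
From HB Require Import structures.
From mathcomp Require Import all_boot all_order all_fingroup all_algebra.
From mathcomp Require Import all_solvable all_field.
From mathcomp Require Import generic_quotient ring_quotient.

Set Implicit Arguments.
Unset Strict Implicit.
Unset Printing Implicit Defensive.

Import GRing.Theory.
Local Open Scope ring_scope.

Definition upd (d : nat) (T : Type) (x : d.-tuple T) (i : 'I_d) (u : T) :
  d.-tuple T := [tuple if j == i then u else tnth x j | j < d].

Section Multilinear.
Variables (F : fieldType) (U W : vectType F) (d : nat).
Implicit Types (f g : d.-tuple U -> W) (x : d.-tuple U).

Definition multilinear f :=
  forall x i a u v,
    f (upd x i (a *: u + v)) = a *: f (upd x i u) + f (upd x i v).

Definition alternating f :=
  forall x i j, i != j -> tnth x i = tnth x j -> f x = 0.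

End Multilinear.

Section ExteriorPower.
Variables (F : fieldType) (d : nat).
Implicit Types U W : vectType F.

Definition incr_tuple (m : nat) :=
  {t : d.-tuple 'I_m | sorted (fun i j : 'I_m => (i < j)%N) t}.

(* The d-th exterior power of U, in coordinates: the value of w : extpow U at *)
(* t = (t_1 < ... < t_d) is the coefficient of w on the basis element         *)
(* b_(t_1) /\ ... /\ b_(t_d), where b is the basis vbasis {:U} of U.  Lemmas  *)
(* wedge_multilinear, wedge_alternating, ext_lift_wedge and ext_lift_unique   *)
(* below are the universal property, so nothing depends on the choice of b.   *)
Definition extpow U : vectType F := {ffun incr_tuple (\dim {:U}) -> F^o}.

Definition basis_tuple U (t : incr_tuple (\dim {:U})) : d.-tuple U :=
  [tuple tnth (vbasis {:U}) (tnth (val t) i) | i < d].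

(* x_1 /\ ... /\ x_d: its coefficients are the maximal minors of the matrix   *)
(* of coordinates of the x_i.                                                 *)
Definition wedge U (x : d.-tuple U) : extpow U :=
  [ffun t : incr_tuple (\dim {:U}) => \det (\matrix_(i < d, j < d)
     coord (vbasis {:U}) (tnth (val t) j) (tnth x i)) : F^o].

Definition ext_lift_fun U W (f : d.-tuple U -> W) (w : extpow U) : W :=
  \sum_t (w : {ffun _ -> F^o}) t *: f (basis_tuple t).

(* The linear map with x_1 /\ ... /\ x_d |-> f x, for f alternating.          *)
Definition ext_lift U W (f : d.-tuple U -> W) : 'Hom(extpow U, W) :=
  linfun (ext_lift_fun f).

End ExteriorPower.

Section Upd.
Variables (d : nat) (T : Type).
Implicit Types (x : d.-tuple T).

Lemma tnth_upd x i u j : tnth (upd x i u) j = if j == i then u else tnth x j.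
Proof. by rewrite tnth_mktuple. Qed.

Lemma upd_id x i : upd x i (tnth x i) = x.
Proof. by apply: eq_from_tnth => j; rewrite tnth_upd; case: eqP => // ->. Qed.

Lemma updC x i j u v : i != j -> upd (upd x i u) j v = upd (upd x j v) i u.
Proof.
move=> ij; apply: eq_from_tnth => k; rewrite !tnth_upd.
by case: (eqVneq k j) => // ->; rewrite eq_sym (negPf ij).
Qed.

Definition permt x (s : 'S_d) : d.-tuple T := [tuple tnth x (s i) | i < d].

End Upd.

Section MultilinearTheory.
Variables (F : fieldType) (U W : vectType F) (d : nat).
Implicit Types (f g : d.-tuple U -> W) (x : d.-tuple U).

Lemma multilinear_eq (b : seq U) f g :
    <<b>>%VS = fullv -> multilinear f -> multilinear g ->
    (forall x, (forall i, tnth x i \in b) -> f x = g x) ->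
  f =1 g.
Proof.
move=> bU fL gL fg.
suff H k : (k <= d)%N ->
    forall x, (forall i : 'I_d, (k <= i)%N -> tnth x i \in b) -> f x = g x.
  by move=> x; apply: (H d) => // i; rewrite leqNgt ltn_ord.
elim: k => [_ x xb | k IHk kd x xb]; first by apply: fg => i; apply: xb.
pose i0 := Ordinal kd.
have hL (h : d.-tuple U -> W) : multilinear h -> linear (fun u : U => h (upd x i0 u)).
  by move=> hL a u v; apply: hL.
pose f1 : {linear U -> W} := HB.pack (fun u : U => f (upd x i0 u))
  (GRing.isLinear.Build F U W *:%R _ (hL f fL)).
pose g1 : {linear U -> W} := HB.pack (fun u : U => g (upd x i0 u))
  (GRing.isLinear.Build F U W *:%R _ (hL g gL)).
suff : f1 (tnth x i0) = g1 (tnth x i0) by rewrite /f1 /g1 /= !upd_id.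
have: tnth x i0 \in <<in_tuple b>>%VS by rewrite bU memvf.
move/coord_span => ->; rewrite !linear_sum; apply: eq_bigr => j _.
rewrite !linearZ; congr (_ *: _) => /=; apply: IHk; first exact: ltnW.
move=> i; rewrite tnth_upd; case: eqP => [_ _|/eqP ne ki].
  by rewrite mem_nth.
by apply: xb; rewrite ltn_neqAle ki andbT eq_sym.
Qed.

Lemma alternating_tperm f x i j : multilinear f -> alternating f -> i != j ->
  f (permt x (tperm i j)) = - f x.
Proof.
move=> fL fA ij.
pose h u v := f (upd (upd x i u) j v).
have hd u : h u u = 0.
  by apply: (fA _ i j ij); rewrite !tnth_upd !eqxx (negPf ij).
have hl u u' v : h (u + u') v = h u v + h u' v.
  by rewrite /h !(updC _ _ _ ij) -[u]scale1r fL !scale1r.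
have hr u v v' : h u (v + v') = h u v + h u v'.
  by rewrite /h -[v]scale1r fL !scale1r.
have := hd (tnth x i + tnth x j); rewrite hl !hr !hd add0r addr0 => /eqP.
rewrite addrC addr_eq0 => /eqP E.
have -> : permt x (tperm i j) = upd (upd x i (tnth x j)) j (tnth x i).
  apply: eq_from_tnth => k; rewrite !tnth_upd tnth_mktuple.
  case: tpermP => [->|->|/eqP/negPf-> /eqP/negPf->] //; rewrite eqxx //.
  by rewrite (negPf ij).
rewrite -/(h _ _) E /h; congr (- f _).
by apply: eq_from_tnth => k; rewrite !tnth_upd; case: eqP => [->|_] //;
  case: eqP => [->|].
Qed.

Lemma alternating_perm f x (s : 'S_d) : multilinear f -> alternating f ->
  f (permt x s) = (-1) ^+ s *: f x.
Proof.
move=> fL fA; case: (prod_tpermP s) => ts -> {s}.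
elim: ts => [_|[i j] ts IH] /=.
  rewrite big_nil odd_perm1 expr0 scale1r; congr f.
  by apply: eq_from_tnth => k; rewrite tnth_mktuple perm1.
case/andP=> ij /IH {}IH; rewrite big_cons /= odd_mul_tperm ij signr_addb.
rewrite expr1 mulN1r scaleNr -IH -(alternating_tperm _ fL fA ij); congr f.
by apply: eq_from_tnth => k; rewrite !tnth_mktuple permM.
Qed.

End MultilinearTheory.

Section ExteriorTheory.
Variables (F : fieldType) (d : nat).
Implicit Types U W : vectType F.

Lemma wedge_multilinear U : multilinear (@wedge F d U).
Proof.
move=> x i a u v; apply/ffunP => t; rewrite !ffunE.
pose M (y : d.-tuple U) : 'M[F]_d :=
  \matrix_(i, j) coord (vbasis {:U}) (tnth (val t) j) (tnth y i).
change (\det (M (upd x i (a *: u + v))) =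
  a * \det (M (upd x i u)) + \det (M (upd x i v))).
rewrite -[\det (M (upd x i v))]mul1r; apply: (@determinant_multilinear _ _ _ _ _ i).
- by apply/rowP => j; rewrite !mxE !tnth_upd eqxx linearP mul1r.
- apply/matrixP => k j; rewrite !mxE !tnth_upd.
  by rewrite eq_sym (negPf (neq_lift _ _)).
- apply/matrixP => k j; rewrite !mxE !tnth_upd.
  by rewrite eq_sym (negPf (neq_lift _ _)).
Qed.

Lemma wedge_alternating U : alternating (@wedge F d U).
Proof.
move=> x i j ij xij; apply/ffunP => t; rewrite !ffunE.
by apply: (determinant_alternate ij) => k; rewrite !mxE xij.
Qed.

Lemma ext_lift_fun_linear U W (f : d.-tuple U -> W) :
  linear (ext_lift_fun f).
Proof.
move=> a u v; rewrite /ext_lift_fun scaler_sumr -big_split /=.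
by apply: eq_bigr => t _; rewrite !ffunE scalerDl scalerA.
Qed.
HB.instance Definition _ U W (f : d.-tuple U -> W) :=
  GRing.isLinear.Build F (extpow d U) W _ (ext_lift_fun f)
    (ext_lift_fun_linear f).

Lemma ext_liftE U W (f : d.-tuple U -> W) w :
  ext_lift f w = \sum_t (w : {ffun _ -> F^o}) t *: f (basis_tuple t).
Proof. by rewrite lfunE. Qed.

Lemma incr_tuple_uniq m (t : incr_tuple d m) : uniq (val t).
Proof.
case: t => t /= tS; have := @sorted_uniq _ _ _ _ _ tS; apply.
  by move=> i j k /ltn_trans; apply.
by move=> i /=; rewrite ltnn.
Qed.

Lemma incr_tuple_perm m (t t' : incr_tuple d m) (s : 'S_d) :
  (forall i, tnth (val t) i = tnth (val t') (s i)) -> t = t' /\ s = 1%g.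
Proof.
move=> H.
have tt' : t = t'.
  apply/val_inj/val_inj; apply: (sorted_eq _ _ (valP t) (valP t')) => /=.
  - by move=> i j k /ltn_trans; apply.
  - by move=> i j /andP[/ltnW ij /ltnW ji]; apply/val_inj/anti_leq/andP.
  apply/tuple_permP; exists s.
  by apply: (congr1 (@tval _ _)); apply: eq_from_tnth => i; rewrite tnth_mktuple.
split=> //; subst t'; apply/permP => i; rewrite perm1.
exact/esym/(tuple_uniqP _ (incr_tuple_uniq t))/H.
Qed.

Lemma coord_basis U (i j : 'I_(\dim {:U})) :
  coord (vbasis {:U}) j (tnth (vbasis {:U}) i) = (i == j)%:R.
Proof.
by rewrite (tnth_nth 0) coord_free ?(basis_free (vbasisP _)) // eq_sym.
Qed.

Lemma det_incr_tuple m (t t' : incr_tuple d m) :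
  \det (\matrix_(i < d, j < d) (tnth (val t) i == tnth (val t') j)%:R)
    = (t == t')%:R :> F.
Proof.
rewrite /determinant (bigD1 1%g) //= odd_perm1 mul1r [X in _ + X]big1 ?addr0.
  case: eqP => [-> | ne]; first by rewrite big1 // => i _; rewrite mxE perm1 eqxx.
  have: [exists i, tnth (val t) i != tnth (val t') i].
    apply/negbNE/negP => /existsPn H; apply: ne.
    apply: (proj1 (@incr_tuple_perm _ _ _ 1%g _)) => i.
    by rewrite perm1; apply/eqP/negbNE.
  by case/existsP=> i Hi; rewrite (bigD1 i) //= mxE perm1 (negPf Hi) mul0r.
move=> s sn1.
have: [exists i, tnth (val t) i != tnth (val t') (s i)].
  apply: contraR sn1 => /existsPn H; apply/eqP.
  by apply: (proj2 (@incr_tuple_perm _ t t' s _)) => i; apply/eqP/negbNE.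
by case/existsP=> i Hi; rewrite (bigD1 i) //= mxE (negPf Hi) mul0r mulr0.
Qed.

Lemma wedge_basis U (t t' : incr_tuple d (\dim {:U})) :
  (wedge (basis_tuple t) : {ffun _ -> F^o}) t' = (t == t')%:R.
Proof.
rewrite ffunE -det_incr_tuple; congr (\det _).
by apply/matrixP => i j; rewrite !mxE tnth_mktuple coord_basis.
Qed.

Lemma ext_decomp U (w : extpow d U) :
  w = \sum_t (w : {ffun _ -> F^o}) t *: wedge (basis_tuple t).
Proof.
apply/ffunP => t; rewrite sum_ffunE (bigD1 t) //= ffunE wedge_basis eqxx.
rewrite [_ *: _]mulr1 big1 ?addr0 // => t' /negPf t't.
by rewrite ffunE wedge_basis t't scaler0.
Qed.

Lemma ext_lift_basis U W (f : d.-tuple U -> W) t :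
  ext_lift f (wedge (basis_tuple t)) = f (basis_tuple t).
Proof.
rewrite ext_liftE (bigD1 t) //= wedge_basis eqxx scale1r big1 ?addr0 //.
by move=> t' /negPf t't; rewrite wedge_basis eq_sym t't scale0r.
Qed.

Lemma alternating_eq U W (f g : d.-tuple U -> W) :
    multilinear f -> alternating f -> multilinear g -> alternating g ->
    (forall t, f (basis_tuple t) = g (basis_tuple t)) ->
  f =1 g.
Proof.
move=> fL fA gL gA fg; apply: (multilinear_eq (b := vbasis {:U})) => //.
  exact: span_basis (vbasisP _).
move=> x xb.
have /fin_all_exists[e xe] i : exists k, tnth x i = tnth (vbasis {:U}) k.
  by apply/tnthP; apply: xb.
have [ie|] := boolP (injectiveb e); last first.
  case/injectivePn => i [j ij eij].
  have xij : tnth x i = tnth x j by rewrite !xe eij.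
  by rewrite (fA _ _ _ ij xij) (gA _ _ _ ij xij).
pose te : d.-tuple 'I_(\dim {:U}) := [tuple e i | i < d].
pose r (i j : 'I_(\dim {:U})) := (i <= j)%N.
have /tuple_permP[s sE] : perm_eq te (sort_tuple r te).
  by rewrite perm_sym perm_sort.
have St : sorted (fun i j : 'I_(\dim {:U}) => (i < j)%N) (sort_tuple r te).
  have : sorted r (sort_tuple r te).
    by apply: sort_sorted => i j; apply: leq_total.
  have : uniq (sort_tuple r te).
    by rewrite /= sort_uniq map_inj_uniq ?enum_uniq //; apply/injectiveP.
  rewrite -(map_inj_uniq val_inj) => un.
  move=> so; have := ltn_sorted_uniq_leq (map val (sort_tuple r te)).
  by rewrite un !sorted_map => ->.
pose t : incr_tuple d (\dim {:U}) := exist _ (sort_tuple r te) St.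
have -> : x = permt (basis_tuple t) s.
  apply: eq_from_tnth => i; rewrite xe !tnth_mktuple; congr tnth.
  have := congr1 (fun q => nth (e i) q i) sE.
  by rewrite -!tnth_nth !tnth_mktuple.
by rewrite !alternating_perm // fg.
Qed.

Lemma ext_lift_wedge U W (f : d.-tuple U -> W) x :
  multilinear f -> alternating f -> ext_lift f (wedge x) = f x.
Proof.
move=> fL fA.
apply: (@alternating_eq U W (fun x => ext_lift f (wedge x)) f) => //.
- by move=> y i a u v; rewrite wedge_multilinear linearP.
- by move=> y i j ij yij; rewrite (wedge_alternating ij yij) linear0.
- exact: ext_lift_basis.
Qed.

Lemma ext_lift_unique U W (g h : 'Hom(extpow d U, W)) :
  (forall x, g (wedge x) = h (wedge x)) -> g = h.
Proof.
move=> gh; apply/lfunP => w; rewrite (ext_decomp w) !linear_sum.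
by apply: eq_bigr => t _; rewrite !linearZ /= gh.
Qed.

End ExteriorTheory.

Section Products.
Variables (F : fieldType) (d : nat) (U : vectType F).

(* The product with a vector: (x_1 /\ ... /\ x_d) /\ u.                       *)
Definition ext_mulr (w : extpow d U) (u : U) : extpow d.+1 U :=
  ext_lift (fun x : d.-tuple U => wedge [tuple of rcons x u]) w.

Lemma tnth_rcons_lift (x : d.-tuple U) u (i : 'I_d.+1) :
  tnth [tuple of rcons x u] i = if unlift ord_max i is Some j then tnth x j else u.
Proof.
rewrite (tnth_nth 0) /= nth_rcons size_tuple; case: unliftP => [j ->|->] /=.
  have -> : bump d j = j by rewrite /bump leqNgt ltn_ord.
  by rewrite ltn_ord -tnth_nth.
by rewrite ltnn eqxx.
Qed.

Lemma rcons_upd (x : d.-tuple U) i u v :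
  [tuple of rcons (upd x i u) v] = upd [tuple of rcons x v] (lift ord_max i) u.
Proof.
apply: eq_from_tnth => j; rewrite tnth_upd !tnth_rcons_lift.
case: (unliftP ord_max j) => [k ->|->].
  by rewrite tnth_upd (inj_eq lift_inj).
by rewrite (negPf (neq_lift _ _)).
Qed.

Lemma ext_mulr_wedge (x : d.-tuple U) u :
  ext_mulr (wedge x) u = wedge [tuple of rcons x u].
Proof.
rewrite /ext_mulr (@ext_lift_wedge F d U _ (fun x => wedge [tuple of rcons x u])) //.
- by move=> y i a v w; rewrite !rcons_upd wedge_multilinear.
- move=> y i j ij yij.
  apply: (@wedge_alternating _ _ _ _ (lift ord_max i) (lift ord_max j)).
    by rewrite (inj_eq lift_inj).
  by rewrite !tnth_rcons_lift !liftK.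
Qed.

End Products.

Section Pairing.
Variables (F : fieldType) (d : nat) (U : vectType F).
Local Notation dual E := 'Hom(E, F^o).

Definition pair_tuple (x : d.-tuple U) (f : d.-tuple (dual U)) : F :=
  \sum_(s : 'S_d) (-1) ^+ s * \prod_(i < d) tnth f i (tnth x (s i)).

Definition pair_hom : 'Hom(extpow d (dual U), dual (extpow d U)) :=
  ext_lift (fun f => ext_lift (fun x => pair_tuple x f : F^o)).

Definition pairing (w : extpow d U) (h : extpow d (dual U)) : F := pair_hom h w.

Lemma pair_tupleE x f :
  pair_tuple x f = \det (\matrix_(i, j) tnth f i (tnth x j)).
Proof.
by apply: eq_bigr => s _; congr (_ * _); apply: eq_bigr => i _; rewrite mxE.
Qed.

Lemma pair_tuple_multil f : multilinear (fun x => pair_tuple x f : F^o).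
Proof.
move=> x i a u v; rewrite !pair_tupleE.
pose M (y : d.-tuple U) : 'M[F]_d := \matrix_(k, j) tnth f k (tnth y j).
change (\det (M (upd x i (a *: u + v))) =
  a * \det (M (upd x i u)) + \det (M (upd x i v))).
rewrite -[\det (M (upd x i v))]mul1r.
rewrite -(det_tr (M (upd x i (a *: u + v)))) -(det_tr (M (upd x i u))).
rewrite -(det_tr (M (upd x i v))).
apply: (@determinant_multilinear _ _ _ _ _ i).
- by apply/rowP => j; rewrite !mxE !tnth_upd eqxx linearP mul1r.
- apply/matrixP => k j; rewrite !mxE !tnth_upd.
  by rewrite eq_sym (negPf (neq_lift _ _)).
- apply/matrixP => k j; rewrite !mxE !tnth_upd.
  by rewrite eq_sym (negPf (neq_lift _ _)).
Qed.

Lemma pair_tuple_altl f : alternating (fun x => pair_tuple x f : F^o).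
Proof.
move=> x i j ij xij; rewrite pair_tupleE -det_tr.
by apply: (determinant_alternate ij) => k; rewrite !mxE xij.
Qed.

Lemma pair_tuple_multir x i a u v f :
  pair_tuple x (upd f i (a *: u + v)) =
  a * pair_tuple x (upd f i u) + pair_tuple x (upd f i v).
Proof.
rewrite !pair_tupleE.
pose M (y : d.-tuple (dual U)) : 'M[F]_d := \matrix_(k, j) tnth y k (tnth x j).
change (\det (M (upd f i (a *: u + v))) =
  a * \det (M (upd f i u)) + \det (M (upd f i v))).
rewrite -[\det (M (upd f i v))]mul1r.
apply: (@determinant_multilinear _ _ _ _ _ i).
- by apply/rowP => j; rewrite !mxE !tnth_upd eqxx add_lfunE scale_lfunE mul1r.
- apply/matrixP => k j; rewrite !mxE !tnth_upd.
  by rewrite eq_sym (negPf (neq_lift _ _)).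
- apply/matrixP => k j; rewrite !mxE !tnth_upd.
  by rewrite eq_sym (negPf (neq_lift _ _)).
Qed.

Lemma pair_tuple_altr x f i j : i != j -> tnth f i = tnth f j ->
  pair_tuple x f = 0.
Proof.
move=> ij fij; rewrite pair_tupleE.
by apply: (determinant_alternate ij) => k; rewrite !mxE fij.
Qed.

Lemma pairing_wedge (x : d.-tuple U) (f : d.-tuple (dual U)) :
  pairing (wedge x) (wedge f) =
  \sum_(s : 'S_d) (-1) ^+ s * \prod_(i < d) tnth f i (tnth x (s i)).
Proof.
pose L (f : d.-tuple (dual U)) : dual (extpow d U) :=
  ext_lift (fun x => pair_tuple x f : F^o).
have LE g y : L g (wedge y) = pair_tuple y g.
  rewrite (@ext_lift_wedge F d U _ (fun y => pair_tuple y g : F^o)) //.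
    exact: pair_tuple_multil.
  exact: pair_tuple_altl.
rewrite /pairing /pair_hom (@ext_lift_wedge F d _ _ L); first exact: LE.
  move=> g i a u v; apply: ext_lift_unique => y.
  by rewrite add_lfunE scale_lfunE !LE pair_tuple_multir.
move=> g i j ij gij; apply: ext_lift_unique => y.
by rewrite LE lfunE /=; apply: (pair_tuple_altr _ ij).
Qed.

Fact pairing_linear w : linear_for *%R (pairing w).
Proof. by move=> a h k; rewrite /pairing linearP add_lfunE scale_lfunE. Qed.

End Pairing.
Arguments pair_hom {F d U}.

HB.instance Definition _ (F : fieldType) d (U : vectType F) (w : extpow d U) :=
  GRing.isLinear.Build F (extpow d 'Hom(U, F^o)) F^o _ (pairing w)
    (@pairing_linear F d U w).

Section PairingTheory.
Variables (F : fieldType) (d : nat) (U : vectType F).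
Local Notation dual E := 'Hom(E, F^o).

Definition dual_tuple (t : incr_tuple d (\dim {:U})) : d.-tuple (dual U) :=
  [tuple linfun (coord (vbasis {:U}) (tnth (val t) i) : U -> F^o) | i < d].

Lemma pairing_dual_tuple t t' :
  pairing (wedge (basis_tuple t)) (wedge (dual_tuple t')) = (t == t')%:R.
Proof.
rewrite pairing_wedge -[RHS](@det_incr_tuple F d) -det_tr.
apply: eq_bigr => s _; congr (_ * _); apply: eq_bigr => i _.
by rewrite !mxE !tnth_mktuple lfunE /= coord_basis.
Qed.

Lemma limg_pair_hom : limg (@pair_hom F d U) = fullv.
Proof.
apply/eqP; rewrite eqEsubv subvf; apply/subvP => /= phi _.
suff -> : phi = pair_hom (\sum_t phi (wedge (basis_tuple t)) *: wedge (dual_tuple t)).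
  exact/memv_img/memvf.
apply/lfunP => w; rewrite (ext_decomp w) !linear_sum; apply: eq_bigr => t _.
rewrite !linearZ /=; congr (_ *: _).
rewrite sum_lfunE (bigD1 t) //= linearZ scale_lfunE.
rewrite -[pair_hom _ _]/(pairing _ _) pairing_dual_tuple eqxx.
rewrite [_ *: _]mulr1 big1 ?addr0 // => t' t't.
rewrite linearZ scale_lfunE -[pair_hom _ _]/(pairing _ _).
by rewrite pairing_dual_tuple eq_sym (negPf t't) scaler0.
Qed.

Lemma dim_dual (E : vectType F) : \dim {: dual E} = \dim {:E}.
Proof. by rewrite !dimvf; apply: muln1. Qed.

Lemma dim_extpow (E : vectType F) :
  \dim {: extpow d E} = #|{: incr_tuple d (\dim {:E})}|.
Proof. by rewrite dimvf; apply: muln1. Qed.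

(* With limg_pair_hom, this says that the pairing is non-degenerate.          *)
Lemma lker_pair_hom : lker (@pair_hom F d U) = 0%VS.
Proof.
apply/eqP; rewrite -dimv_eq0 -(eqn_add2r (\dim (limg (@pair_hom F d U)))).
rewrite -[in X in X == _](capfv (lker _)) limg_ker_dim limg_pair_hom add0n.
by rewrite dim_dual !dim_extpow dim_dual.
Qed.

End PairingTheory.

Section DualMap.
Variables (F : fieldType) (d : nat) (U V : vectType F).
Local Notation dual E := 'Hom(E, F^o).

(* The dual map V^* -> /\^d(U^* ) of g : /\^d U -> V, where (/\^d U)^* is     *)
(* identified with /\^d(U^* ) through the pairing.                            *)
Definition ext_dual (g : 'Hom(extpow d U, V)) (f : dual V) :
  extpow d (dual U) := (pair_hom^-1)%VF (f \o g)%VF.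

Lemma pairing_ext_dual g f w : pairing w (ext_dual g f) = f (g w).
Proof.
by rewrite /pairing /ext_dual limg_lfunVK ?limg_pair_hom ?memvf // comp_lfunE.
Qed.

End DualMap.

Section Subspaces.
Variables (F : finFieldType) (E : vectType F).

(* F is finite, so the vectors satisfying P can be enumerated.                *)
Definition spanv (P : {pred finvect_type E}) : {vspace E} := <<(enum P : seq E)>>%VS.

Lemma spanv_subP (P : {pred finvect_type E}) (W : {vspace E}) :
  reflect (forall x : finvect_type E, x \in P -> x \in W) (spanv P <= W)%VS.
Proof.
have mP x : (x \in (enum P : seq E)) = (x \in P) by exact: (mem_enum P x).
by apply: (iffP span_subvP) => H x => [Px | /[!mP]]; apply: H; rewrite ?mP.
Qed.

(* The quotient space W / K, for K contained in W.                            *)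
Definition quotv (W K : {vspace E}) : zmodType :=
  Quotient.quot (pred_of_vspace (linfun (@vsval F E W) @^-1: K)%VS).

Lemma quotv_eq0P (W K : {vspace E}) :
  (forall c : quotv W K, c = 0) <-> (W <= K)%VS.
Proof.
have Wpi (x y : subvs_of W) :
    (\pi_(quotv W K)%qT x == \pi_(quotv W K)%qT y) = (vsval (x - y) \in K).
  by rewrite -Quotient.idealrBE -memv_preim lfunE.
split=> [H | WK].
  apply/subvP => x xW; rewrite -(vsprojK xW) -[vsproj W x]subr0 -Wpi.
  by rewrite (H (\pi _)%qT) (H (\pi 0)%qT).
elim/quotW => x.
have -> : 0 = \pi_(quotv W K)%qT 0 by rewrite piE.
by apply/eqP; rewrite Wpi subr0 (subvP WK) ?subvsP.
Qed.

End Subspaces.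

Section Orthogonal.
Variables (F : finFieldType) (d : nat) (U : vectType F).
Local Notation dual E := 'Hom(E, F^o).

Definition orthl (K : {vspace extpow d (dual U)}) : {vspace extpow d U} :=
  (\bigcap_(h : finvect_type (extpow d (dual U)) | h \in K) lker (pair_hom h))%VS.

Definition orthr (S : {vspace extpow d U}) : {vspace extpow d (dual U)} :=
  (\bigcap_(w : finvect_type (extpow d U) | w \in S) lker (linfun (pairing w : _ -> F^o)))%VS.

Lemma orthlP (K : {vspace extpow d (dual U)}) (w : extpow d U) :
  reflect (forall h, h \in K -> pairing w h = 0) (w \in orthl K).
Proof.
rewrite memvE; apply: (iffP subv_bigcapP) => H h hK.
  by have := H h hK; rewrite -memvE memv_ker => /eqP.
by rewrite -memvE memv_ker; apply/eqP/H.
Qed.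

Lemma orthrP (S : {vspace extpow d U}) (h : extpow d (dual U)) :
  reflect (forall w, w \in S -> pairing w h = 0) (h \in orthr S).
Proof.
rewrite memvE; apply: (iffP subv_bigcapP) => H w wS.
  by have := H w wS; rewrite -memvE memv_ker lfunE => /eqP.
by rewrite -memvE memv_ker lfunE; apply/eqP/H.
Qed.

End Orthogonal.

Section Degree3.
Variables (F : finFieldType) (U V : vectType F) (gamma : 'Hom(extpow 2 U, V)).
Local Notation dual E := 'Hom(E, F^o).

Definition K3 : {vspace extpow 3 (dual U)} :=
  spanv [pred x | [exists f : finvect_type (dual V),
    [exists g : finvect_type (dual U), x == ext_mulr (ext_dual gamma f) g]]].

Definition S3 : {vspace extpow 3 U} := orthl K3.

Definition S3dec : {vspace extpow 3 U} :=
  spanv [pred x | (x \in S3) && [exists u' : finvect_type (extpow 2 U),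
    [exists u : finvect_type U, x == ext_mulr u' u]]].

Definition K3max : {vspace extpow 3 (dual U)} := orthr S3dec.

Lemma K3_sub_K3max : (K3 <= K3max)%VS.
Proof.
apply/subvP => h hK; apply/orthrP => w wS.
have /subvP sS : (S3dec <= S3)%VS.
  by apply: (introT (@spanv_subP F (extpow 3 U) _ S3)) => x /andP[].
by apply: (orthlP _ _ (sS w wS)).
Qed.

End Degree3.

(* Not mathcomp's [~ x, y], which is x^-1 * y^-1 * x * y.                     *)
Definition comm (gT : finGroupType) (x y : gT) : gT := (x * y * x^-1 * y^-1)%g.

Record central_extension (F : fieldType) (V U : vectType F)
    (gT : finGroupType) (G : {group gT}) (iota : V -> gT) (pi : gT -> U) :
  Prop := CentralExtension {
    cext_iotaD : forall x y, iota (x + y) = (iota x * iota y)%g;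
    cext_iota_inj : injective iota;
    cext_iota_central : forall x, iota x \in 'Z(G)%g;
    cext_piM : {in G &, forall g h, pi (g * h)%g = pi g + pi h};
    cext_pi_surj : forall x, exists2 g, g \in G & pi g = x;
    cext_exact : {in G, forall g, pi g = 0 <-> exists x, g = iota x}
  }.

(* Main.v *)
(* By non-degeneracy of the pairing, a form h in K3max lies in K3 as soon as it
   equals (f o gamma) /\ g for some f and g.  Let e be a symplectic basis, and
   call a pair (a, b) hyperbolic if gamma(e_a /\ e_b) = v.  The e_a /\ e_b /\ e_c
   without hyperbolic pair and the (e_a /\ e_b - e_a' /\ e_b') /\ e_c, with
   hyperbolic pairs (a, b) and (a', b') avoiding c, lie in S3 and are visibly of
   the form u' /\ u; so h vanishes on them.  Hence h(e_a, e_b, e_c) does not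
   depend on the hyperbolic pair (a, b) avoiding c, and this common value defines
   g(e_c). *)
Require Import Defs.
From HB Require Import structures.
From mathcomp Require Import all_boot all_order all_fingroup all_algebra.
From mathcomp Require Import all_solvable all_field ring.

Import GRing.Theory.
Local Open Scope ring_scope.

Set Implicit Arguments.
Unset Strict Implicit.

Lemma basis_form (F : fieldType) (E : vectType F) m (e : m.-tuple E) (y : 'I_m -> F) :
  free e -> exists g : 'Hom(E, F^o), forall j, g (tnth e j) = y j.
Proof.
move=> eF; exists (\sum_j y j *: linfun (coord e j : E -> F^o)) => i.
rewrite sum_lfunE (bigD1 i) //= scale_lfunE lfunE /= (tnth_nth 0).
rewrite coord_free // eqxx [_ *: _]mulr1 big1 ?addr0 // => j ji.
by rewrite scale_lfunE lfunE /= coord_free // eq_sym (negPf ji) scaler0.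
Qed.

(** * Evaluating the pairing on products of forms *)

Section Pairing.
Variables (F : fieldType) (U : vectType F).
Local Notation dual := 'Hom(U, F^o).

(** [pair_hom] has trivial kernel, and a linear form on an exterior power is determined by its
    values on pure wedges. *)
Lemma pairing_inj d (h k : extpow d dual) :
  (forall x, pairing (wedge x) h = pairing (wedge x) k) -> h = k.
Proof.
move=> hk; apply: (lker0P (introT eqP (@lker_pair_hom F d U))).
exact: ext_lift_unique.
Qed.

Lemma pairing02 d (w : extpow d U) : pairing w 0 = 0.
Proof. by rewrite /pairing linear0 lfunE. Qed.

Lemma pairingB1 d (w w' : extpow d U) (h : extpow d dual) :
  pairing (w - w') h = pairing w h - pairing w' h.
Proof. by rewrite /pairing linearB. Qed.

Lemma pairingN1 d (w : extpow d U) (h : extpow d dual) :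
  pairing (- w) h = - pairing w h.
Proof. by rewrite /pairing linearN. Qed.

Lemma pairing_wedge_multilinear d (h : extpow d dual) :
  multilinear (fun x : d.-tuple U => pairing (wedge x) h : F^o).
Proof. by move=> x i a u v; rewrite /pairing wedge_multilinear linearP. Qed.

Lemma pairing_wedge_alternating d (h : extpow d dual) :
  alternating (fun x : d.-tuple U => pairing (wedge x) h : F^o).
Proof.
by move=> x i j ij xij; rewrite /pairing (wedge_alternating ij xij) linear0.
Qed.

(** Reduces an identity linear in [w] to pure wedges, since these span the exterior power. *)
Lemma ext_ind d (E : vectType F) (P : extpow d E -> Prop) :
  P 0 -> (forall a x w, P w -> P (a *: wedge x + w)) -> forall w, P w.
Proof.
move=> P0 PD w; rewrite (ext_decomp w).
by elim/big_rec: _ => // t k _; apply: PD.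
Qed.

(** By linearity in [k] one may take [k] to be a wedge of two forms. Both sides are then made of
    determinants, and the identity is the Laplace expansion along the row of [g]. *)
Lemma pairing_ext_mulr (x y z : U) (k : extpow 2 dual) (g : dual) :
  pairing (wedge [tuple x; y; z]) (ext_mulr k g) =
    pairing (wedge [tuple x; y]) k * g z
    - pairing (wedge [tuple x; z]) k * g y
    + pairing (wedge [tuple y; z]) k * g x.
Proof.
elim/ext_ind: k => [|a f k IHk].
  by rewrite /ext_mulr linear0 !pairing02; ring.
rewrite {1}/ext_mulr linearP -!/(ext_mulr _ _) !pairing_linear {}IHk.
suff -> : pairing (wedge [tuple x; y; z]) (ext_mulr (wedge f) g) =
    pairing (wedge [tuple x; y]) (wedge f) * g z
    - pairing (wedge [tuple x; z]) (wedge f) * g y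
    + pairing (wedge [tuple y; z]) (wedge f) * g x by ring.
rewrite ext_mulr_wedge !pairing_wedge -!/(pair_tuple _ _) !pair_tupleE.
rewrite (expand_det_row _ ord_max) !big_ord_recl big_ord0 /cofactor.
rewrite !(expand_det_row _ ord0) !big_ord_recl !big_ord0 /cofactor !det_mx11.
by rewrite !mxE !(tnth_nth 0) /= !nth_rcons size_tuple /bump /=; ring.
Qed.

End Pairing.

(** * Signs of transpositions in wedges *)

Section Wedge.
Variables (F : fieldType) (U : vectType F).

Lemma wedge2C (a b : U) : wedge [tuple b; a] = - wedge [tuple a; b].
Proof.
rewrite -(@alternating_tperm _ _ _ _ _ [tuple a; b] ord0 (lift ord0 ord0)
  (@wedge_multilinear _ _ _) (@wedge_alternating _ _ _)) //.
congr wedge; apply: eq_from_tnth => i.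
by rewrite tnth_mktuple !(tnth_nth 0) permE; case: i => [[|[|i]]].
Qed.

Lemma wedge3Cl (a b c : U) : wedge [tuple b; a; c] = - wedge [tuple a; b; c].
Proof.
rewrite -(@alternating_tperm _ _ _ _ _ [tuple a; b; c] ord0 (lift ord0 ord0)
  (@wedge_multilinear _ _ _) (@wedge_alternating _ _ _)) //.
congr wedge; apply: eq_from_tnth => i.
by rewrite tnth_mktuple !(tnth_nth 0) permE; case: i => [[|[|[|i]]]].
Qed.

Lemma wedge3Cr (a b c : U) : wedge [tuple a; c; b] = - wedge [tuple a; b; c].
Proof.
rewrite -(@alternating_tperm _ _ _ _ _ [tuple a; b; c] (lift ord0 ord0) ord_max
  (@wedge_multilinear _ _ _) (@wedge_alternating _ _ _)) //.
congr wedge; apply: eq_from_tnth => i.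
by rewrite tnth_mktuple !(tnth_nth 0) permE; case: i => [[|[|[|i]]]].
Qed.

End Wedge.

(** * Membership criteria in degree three *)

Section DegreeThree.
Variables (F : finFieldType) (U V : vectType F) (gamma : 'Hom(extpow 2 U, V)).
Local Notation dual E := 'Hom(E, F^o).

Lemma mem_K3 (f : dual V) (g : dual U) :
  ext_mulr (ext_dual gamma f) g \in K3 gamma.
Proof.
apply: memv_span; rewrite (mem_enum _ (_ : finvect_type _)) inE.
by apply/existsP; exists f; apply/existsP; exists g.
Qed.

(** [K3] is a span, and the kernel of the pairing with [w] is a subspace, so testing the generators
    is enough. *)
Lemma mem_S3 (w : extpow 3 U) :
  (forall f g, pairing w (ext_mulr (ext_dual gamma f) g) = 0) ->
  w \in Defs.S3 gamma.
Proof.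
move=> w0; apply/orthlP => h hK.
have /subvP/(_ h hK) : (K3 gamma <= lker (linfun (pairing w : _ -> F^o)))%VS.
  apply: (introT (@spanv_subP F (extpow 3 (dual U)) _ _)) => x.
  case/existsP=> f /existsP[g /eqP ->].
  by rewrite memv_ker lfunE /= w0.
by rewrite memv_ker lfunE => /eqP.
Qed.

Lemma K3max_dec0 (h : extpow 3 (dual U)) (u' : extpow 2 U) (u : U) :
  h \in K3max gamma -> ext_mulr u' u \in Defs.S3 gamma ->
  pairing (ext_mulr u' u) h = 0.
Proof.
move=> /orthrP hK wS; apply: hK; apply: memv_span.
rewrite (mem_enum _ (_ : finvect_type _)) inE wS /=.
by apply/existsP; exists u'; apply/existsP; exists u.
Qed.

End DegreeThree.

(** * Bases made of hyperbolic pairs *)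

Section HyperbolicBasis.
Variables (F : finFieldType) (U V : vectType F) (gamma : 'Hom(extpow 2 U, V)).
Local Notation dual E := 'Hom(E, F^o).

Variables (v : V) (m : nat) (e : m.-tuple U).
Local Notation w a b := (gamma (wedge [tuple tnth e a; tnth e b])).
Local Notation tri a b c := (wedge [tuple tnth e a; tnth e b; tnth e c]).

Hypotheses (v_neq0 : v != 0) (e_basis : basis_of {:U} e).
(** The features of a symplectic basis used below, stated without numbering its pairs: by [w_match]
    an index has at most one hyperbolic partner. *)
Hypothesis w_val : forall a b, w a b \in [:: 0; v; - v].
Hypothesis w_match : forall a b c, w a b != 0 -> w a c != 0 -> b = c.

Let wC a b : w b a = - w a b.
Proof. by rewrite wedge2C linearN. Qed.

Let w_match0 a b c : w a b != 0 -> b != c -> w a c = 0.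
Proof. by move=> ab /eqP bc; apply/eqP/negP => /negP /(w_match ab). Qed.

Lemma isotropic_mem_S3 a b c :
  w a b = 0 -> w a c = 0 -> w b c = 0 -> tri a b c \in Defs.S3 gamma.
Proof.
move=> ab ac bc; apply: mem_S3 => f g.
by rewrite pairing_ext_mulr !pairing_ext_dual ab ac bc linear0; ring.
Qed.

(** In each expansion only the term with [g (tnth e c)] survives, and these two terms are equal. *)
Lemma hyperbolic_diff_mem_S3 a b a' b' c :
    w a b = w a' b' -> w a c = 0 -> w b c = 0 -> w a' c = 0 -> w b' c = 0 ->
  tri a b c - tri a' b' c \in Defs.S3 gamma.
Proof.
move=> ab ac bc ac' bc'; apply: mem_S3 => f g.
rewrite pairingB1 !pairing_ext_mulr !pairing_ext_dual ab ac bc ac' bc' linear0.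
by ring.
Qed.

Lemma tri_mulr a b c :
  tri a b c = ext_mulr (wedge [tuple tnth e a; tnth e b]) (tnth e c).
Proof. by rewrite ext_mulr_wedge; congr wedge; apply: val_inj. Qed.

Lemma K3max_sub_K3 : (K3max gamma <= K3 gamma)%VS.
Proof.
apply/subvP => h hK.
have eF := basis_free e_basis.
have isotropic0 a b c : w a b = 0 -> w a c = 0 -> w b c = 0 ->
    pairing (tri a b c) h = 0.
  move=> ab ac bc; have := isotropic_mem_S3 ab ac bc.
  by rewrite tri_mulr; apply: K3max_dec0.
have hyperbolic_eq a b a' b' c : w a b = w a' b' -> w a c = 0 -> w b c = 0 ->
    w a' c = 0 -> w b' c = 0 -> pairing (tri a b c) h = pairing (tri a' b' c) h.
  move=> ab ac bc ac' bc'; apply/eqP; rewrite -subr_eq0 -pairingB1; apply/eqP.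
  have := hyperbolic_diff_mem_S3 ab ac bc ac' bc'.
  have -> : tri a b c - tri a' b' c = ext_mulr (wedge [tuple tnth e a; tnth e b]
      - wedge [tuple tnth e a'; tnth e b']) (tnth e c).
    by rewrite !tri_mulr /ext_mulr linearB.
  exact: K3max_dec0.
pose avoid c (ab : 'I_m * 'I_m) :=
  [&& w ab.1 ab.2 == v, w ab.1 c == 0 & w ab.2 c == 0].
(* If no hyperbolic pair avoids [c], as happens for a single pair, then [hyperbolic] below is
   vacuous for this [c], and the default 0 is harmless. *)
pose y c := if [pick ab | avoid c ab] is Some ab
  then pairing (tri ab.1 ab.2 c) h else 0.
have [g gE] := basis_form y eF.
have [f fv] : exists f : dual V, f v = 1.
  have vF : free [tuple v] by rewrite seq1_free.
  have [f fE] := basis_form (fun=> 1) vF.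
  by exists f; rewrite -(fE ord0).
have hyperbolic a b c : w a b != 0 -> w a c = 0 -> w b c = 0 ->
    pairing (tri a b c) h = f (w a b) * g (tnth e c).
  (* [y c] was read off the pair found by [pick]; [hyperbolic_eq] carries its value over to any
     other pair. *)
  have val_v a' b' : w a' b' = v -> w a' c = 0 -> w b' c = 0 ->
      pairing (tri a' b' c) h = g (tnth e c).
    move=> ab ac bc; rewrite gE /y; case: pickP => [[a1 b1]|/(_ (a', b'))].
      case/and3P=> /= /eqP ab1 /eqP ac1 /eqP bc1.
      by apply: hyperbolic_eq; rewrite ?ab.
    by rewrite /avoid ab ac bc !eqxx.
  move=> ab0 ac bc; have := w_val a b; rewrite !inE.
  case/or3P=> /eqP ab; first by rewrite ab eqxx in ab0.
    by rewrite ab fv mul1r val_v.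
  (* For the value [- v], the reversed pair [(b, a)] has value [v], and the sign from swapping the
     first two factors matches [f (- v) = -1]. *)
  rewrite ab linearN /= fv mulN1r -(val_v b a) //; last by rewrite wC ab opprK.
  by rewrite wedge3Cl pairingN1.
suff -> : h = ext_mulr (ext_dual gamma f) g by apply: mem_K3.
apply: pairing_inj; pose k := ext_mulr (ext_dual gamma f) g; rewrite -/k.
change ((fun x : 3.-tuple U => pairing (wedge x) h : F^o)
  =1 (fun x => pairing (wedge x) k)).
(* Both sides are multilinear and alternating in [x], so it remains to compare them on triples of
   distinct basis vectors. *)
apply: (multilinear_eq (span_basis e_basis)); try exact: pairing_wedge_multilinear.
move=> x xe.
have /fin_all_exists[s xs] i : exists j, tnth x i = tnth e j.
  exact/tnthP.
have [sI|/injectivePn[i [j ij sij]]] := boolP (injectiveb s); last first.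
  have xij : tnth x i = tnth x j by rewrite !xs sij.
  by rewrite !(pairing_wedge_alternating _ ij xij).
set i1 := lift ord0 (ord0 : 'I_2).
have neq i j : i != j -> s i != s j by rewrite (inj_eq (injectiveP s sI)).
have {neq} [ab ac bc] := And3 (neq ord0 i1 isT) (neq ord0 ord_max isT)
  (neq i1 ord_max isT).
have {xs xe sI} -> :
    x = [tuple tnth e (s ord0); tnth e (s i1); tnth e (s ord_max)].
  apply: eq_from_tnth => i; rewrite xs (tnth_nth 0 _ i).
  by case: i => [[|[|[|//]]]] ilt /=; congr (tnth e (s _)); apply: val_inj.
move: (s ord0) (s i1) (s ord_max) ab ac bc => a b c ab ac bc.
rewrite pairing_ext_mulr !pairing_ext_dual.
(* By [w_match] at most one of the three pairs is hyperbolic. In that case only the corresponding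
   term of the expansion remains; otherwise the triple is isotropic. *)
have [wab|wab] := eqVneq (w a b) 0; last first.
  have wac := w_match0 wab bc.
  have wbc : w b c = 0.
    by apply: (w_match0 (b := a)); rewrite ?(wC a) ?oppr_eq0.
  by rewrite hyperbolic // wac wbc linear0; ring.
have [wac|wac] := eqVneq (w a c) 0; last first.
  have wcb : w c b = 0.
    by apply: (w_match0 (b := a)); rewrite ?(wC a) ?oppr_eq0.
  have := hyperbolic a c b wac wab wcb.
  rewrite wedge3Cr pairingN1 => /(canRL opprK) ->.
  by rewrite wab (wC c b) wcb oppr0 linear0; ring.
have [wbc|wbc] := eqVneq (w b c) 0; last first.
  (* The triple [(b, c, a)] is a cyclic rotation of [(a, b, c)], so the two signs cancel. *)
  have := hyperbolic b c a wbc; rewrite wC wab (wC a c) wac oppr0.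
  move=> /(_ erefl erefl); rewrite wedge3Cr wedge3Cl opprK => ->.
  by rewrite linear0; ring.
by rewrite isotropic0 // wab wac wbc linear0; ring.
Qed.

End HyperbolicBasis.

(** * Application to the extraspecial group *)

Unset Implicit Arguments.

Theorem proposition3p1 (p n : nat) (gT : finGroupType) (G : {group gT})
    (V U : vectType 'F_p) (iota : V -> gT) (pi : gT -> U) (v : V)
    (u : (2 * n).-tuple U) (t : 'I_(2 * n) -> gT)
    (gamma : 'Hom(extpow 2 U, V))
    (p_prime : prime p) (p_odd : odd p) (n_ge1 : (1 <= n)%N)
    (pG : (p.-group G)%g) (G_extraspecial : extraspecial G)
    (G_exponent : exponent G = p) (G_order : #|G| = (p ^ (2 * n + 1))%N)
    (G_ext : central_extension G iota pi)
    (V_dim : \dim {:V} = 1%N) (V_gen : <[v]>%VS = {:V}%VS)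
    (iota_center : forall g, g \in 'Z(G)%g <-> exists x, g = iota x)
    (iota_der : forall g, g \in (G^`(1))%g <-> exists x, g = iota x)
    (u_basis : basis_of {:U} u)
    (t_lift : forall j, t j \in G /\ pi (t j) = tnth u j)
    (t_comm : forall j l : 'I_(2 * n), (j < l)%N ->
       comm (t j) (t l) =
         if ~~ odd j && (l == j.+1 :> nat) then iota v else 1%g)
    (gamma_comm : {in G &, forall g1 g2,
       iota (gamma (wedge [tuple pi g1; pi g2])) = comm g1 g2}) :
  forall c : quotv (K3max gamma) (K3 gamma), c = 0.
Proof.
apply/quotv_eq0P.
have t_in j : t j \in G by case: (t_lift j).
have pi_t j : pi (t j) = tnth u j by case: (t_lift j).
have iota0 : iota 0 = 1%g.
  by apply: (mulgI (iota 0)); rewrite -(cext_iotaD G_ext) addr0 mulg1.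
(* Injectivity of [iota] lets [gamma] be read off the commutators of the lifts. Indices start at 0,
   so a hyperbolic pair begins at an even index. *)
have w_lt (a b : 'I_(2 * n)) : (a < b)%N ->
    gamma (wedge [tuple tnth u a; tnth u b]) =
    if ~~ odd a && (b == a.+1 :> nat) then v else 0.
  move=> ab; apply: (cext_iota_inj G_ext).
  rewrite -(pi_t a) -(pi_t b) gamma_comm // t_comm //.
  by case: ifP; rewrite ?iota0.
have w_gt (a b : 'I_(2 * n)) : (b < a)%N ->
    gamma (wedge [tuple tnth u a; tnth u b]) =
    if ~~ odd b && (a == b.+1 :> nat) then - v else 0.
  move=> /w_lt ba; rewrite wedge2C linearN /= ba.
  by case: ifP; rewrite ?oppr0.
have w_eq (a : 'I_(2 * n)) : gamma (wedge [tuple tnth u a; tnth u a]) = 0.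
  by rewrite (@wedge_alternating _ _ _ _ ord0 ord_max) ?linear0.
(* The partner is an explicit function of [a], which gives the uniqueness required by [w_match]. *)
have w_partner (a b : 'I_(2 * n)) :
    gamma (wedge [tuple tnth u a; tnth u b]) != 0 ->
    b = (if odd a then a.-1 else a.+1) :> nat.
  case: (ltngtP a b) => [ab | ba | /val_inj <-]; last by rewrite w_eq eqxx.
    by rewrite w_lt //; case: ifP => [/andP[/negPf-> /eqP->]|]; rewrite ?eqxx.
  rewrite w_gt //; case: ifP => [/andP[ob /eqP->]|]; rewrite ?eqxx //=.
  by rewrite ob.
apply: (@K3max_sub_K3 _ _ _ gamma v _ u) => //.
(* The line spanned by [v] has dimension 1 exactly when [v] is nonzero. *)
- by rewrite -(eqb1 (v != 0)) -dim_vline V_gen V_dim.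
- move=> a b; rewrite !inE; case: (ltngtP a b) => [ab | ba | /val_inj <-].
  + by rewrite w_lt //; case: ifP; rewrite eqxx ?orbT.
  + by rewrite w_gt //; case: ifP; rewrite eqxx ?orbT.
  + by rewrite w_eq eqxx.
- move=> a b c /w_partner ab /w_partner ac.
  by apply: val_inj; rewrite /= ab ac.
Qed.
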